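(* Let $\mathcal{I}$ be a proper admissible ideal on $\mathbb{N}$ having a pseudounion. Then a Tychonoff space $X$ is H-separable if and only if it is $\mathcal{I}$-H-separable.
   Context: An ideal on $\mathbb{N}$ is a family of subsets of $\mathbb{N}$ closed under finite unions and under subsets; it is admissible if it contains every singleton and proper if it does not contain $\mathbb{N}$. $C\subseteq^* D$ means that $C\setminus D$ is finite. A set $D\subseteq\mathbb{N}$ is a pseudounion of a family $\mathcal{C}$ of subsets of $\mathbb{N}$ if $\mathbb{N}\setminus D$ is infinite and $C\subseteq^* D$ for every $C\in\mathcal{C}$. A space $X$ is $\mathcal{I}$-H-separable if for every sequence $(Y_n)_{n\in\mathbb{N}}$ of dense subspaces of $X$ there is a sequence $(F_n)_{n\in\mathbb{N}}$ such that each $F_n$ is a finite subset of $Y_n$ and for every nonempty open set $U$ of $X$, $\{n\in\mathbb{N} : U\cap F_n=\emptyset\}\in\mathcal{I}$. $X$ is H-separable if for every sequence $(Y_n)$ of dense subspaces of $X$ there is a sequence $(F_n)$ such that each $F_n$ is a finite subset of $Y_n$ and every nonempty open set of $X$ intersects $F_n$ for all but finitely many $n$. *)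

(* Defs.v *)
From mathcomp Require Import all_boot.
From mathcomp Require Import boolp classical_sets functions cardinality.
From mathcomp Require Import topology normedtype.

Set Implicit Arguments.
Unset Strict Implicit.
Unset Printing Implicit Defensive.

Local Open Scope classical_set_scope.

(* [ideal_set0] is the empty finite union; it is redundant for admissible
   ideals. *)
Record set_ideal (I : set (set nat)) : Prop := SetIdeal {
  ideal_set0 : I set0;
  ideal_setU : forall A B : set nat, I A -> I B -> I (A `|` B);
  ideal_subset : forall A B : set nat, A `<=` B -> I B -> I A }.

Definition ideal_admissible (I : set (set nat)) : Prop :=
  forall n : nat, I [set n].

Definition ideal_proper (I : set (set nat)) : Prop := ~ I setT.

Definition almost_subset (C D : set nat) : Prop := finite_set (C `\` D).

Definition pseudounion (F : set (set nat)) (D : set nat) : Prop :=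
  infinite_set (~` D) /\ forall C : set nat, F C -> almost_subset C D.

Definition ideal_H_separable (I : set (set nat)) (X : topologicalType) : Prop :=
  forall Y : nat -> set X, (forall n, dense (Y n)) ->
  exists F : nat -> set X,
    (forall n, finite_set (F n) /\ F n `<=` Y n) /\
    forall U : set X, open U -> U !=set0 ->
      I [set n | U `&` F n = set0].

Definition H_separable (X : topologicalType) : Prop :=
  forall Y : nat -> set X, (forall n, dense (Y n)) ->
  exists F : nat -> set X,
    (forall n, finite_set (F n) /\ F n `<=` Y n) /\
    forall U : set X, open U -> U !=set0 ->
      finite_set [set n | ~ (U `&` F n !=set0)].

(* [completely_regular_space] separates points from closed sets by uniformities
   coarser than the topology; by [uniform_separatorP] this is separation by
   continuous functions into [0, 1].  It does not include any T_i axiom. *)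
Definition tychonoff_space (X : topologicalType) : Prop :=
  accessible_space X /\ completely_regular_space X.

(* Main.v *)
Require Import Defs.
From mathcomp Require Import all_boot.
From mathcomp Require Import boolp classical_sets functions cardinality.
From mathcomp Require Import topology normedtype.

Local Open Scope classical_set_scope.

(** An admissible ideal contains all finite sets, so H-separability gives its
    ideal version with the same finite sets.  For the converse, a pseudounion
    [D] of [I] makes every member of [I] finite off [D], and the infinite set
    [~` D] contains an injective sequence [e].  Reindex a given sequence of
    dense sets [Y] so that [Y k] sits at position [e k], select finite sets for
    the reindexed sequence, and read them off along [e].  The [k] at which an
    open set is missed are the preimage under [e] of a member of [I], and this
    preimage is finite by injectivity of [e]. *)

Lemma finite_set_in_ideal (I : set (set nat)) (A : set nat) :
  set_ideal I -> ideal_admissible I -> finite_set A -> I A.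
Proof.
move=> idealI admI /finite_seqP[s ->].
elim: s => [|n s IHs]; first by rewrite set_nil; exact: ideal_set0 idealI.
have -> : [set` n :: s] = [set n] `|` [set` s].
  apply/seteqP; split=> m /=; rewrite inE.
    by case/orP=> [/eqP|]; [left|right].
  by case=> [->|->]; rewrite ?eqxx ?orbT.
by exact: (ideal_setU idealI).
Qed.

Lemma infinite_set_injective_sequence (T : pointedType) (E : set T) :
  infinite_set E -> exists2 e : nat -> T, injective e & forall k, E (e k).
Proof.
move=> /infiniteP/pcard_leP[f].
exists f => [x y fxy|k]; last exact: 'funS_f.
by apply: 'inj_f fxy; rewrite inE.
Qed.

(** Reindexing along [e] is possible because a left inverse of [e] names the
    dense set to be used at every position, including those off the range. *)
Lemma ideal_H_separable_reindex (I : set (set nat)) (X : topologicalType)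
    (e : nat -> nat) :
  injective e -> (forall A, I A -> finite_set (e @^-1` A)) ->
  ideal_H_separable I X -> H_separable X.
Proof.
move=> inj_e finI sepX Y denseY.
have [g eK] : exists g : nat -> nat, cancel e g.
  exists ('pinv_(fun=> 0) setT e) => k.
  by apply: pinvKV; rewrite ?inE // => x y _ _ /inj_e.
have [G [GY missG]] := sepX (Y \o g) (fun n => denseY (g n)).
exists (G \o e); split=> [k|U openU U0].
  by have [finG subG] := GY (e k); split=> //= x /subG /=; rewrite eK.
apply: sub_finite_set (finI _ (missG U openU U0)) => k /=.
by move/set0P/negP/negPn/eqP.
Qed.

Theorem theorem3p7 (I : set (set nat)) (X : topologicalType)
    (idealI : set_ideal I) (properI : ideal_proper I)
    (admissibleI : ideal_admissible I)
    (pseudounionI : exists D : set nat, pseudounion I D)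
    (tychonoffX : tychonoff_space X) :
  H_separable X <-> ideal_H_separable I X.
Proof.
split=> [sepX Y denseY|].
  have [F [FY missF]] := sepX Y denseY; exists F; split=> // U openU U0.
  apply: finite_set_in_ideal => //.
  apply: sub_finite_set (missF U openU U0) => n /= UF0.
  by rewrite UF0 => -[].
have [D [infD almostD]] := pseudounionI.
have [e inj_e eD] := infinite_set_injective_sequence _ _ infD.
apply: (ideal_H_separable_reindex I X e inj_e) => A /almostD finAD.
have -> : e @^-1` A = e @^-1` (A `\` D).
  by apply/seteqP; split=> k /= => [Ak|[]//]; split=> //; exact: eD.
by apply: finite_preimage finAD => x y _ _ /inj_e.
Qed.
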